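(* Let $\vec{S}_3$ be the directed graph on vertex set $\{1,2,3\}$ with arc set $\{\vec{12},\vec{13}\}$. Then \[\pi_{\vec{S}_3}(\emptyset)=2\sqrt{3}-3,\] i.e. the limit as $n\to\infty$ of the maximum, over directed graphs $D$ on $n$ vertices, of the number of $3$-element vertex subsets of $D$ inducing a copy of $\vec{S}_3$, divided by $\binom{n}{3}$, equals $2\sqrt3-3$.
   Context: A directed graph is a pair $(V,E)$ with $E$ a set of ordered pairs $\vec{xy}$ of distinct vertices. A set $S\subseteq V$ induces a copy of a directed graph $H$ if the directed graph on $S$ consisting of all arcs of $E$ with both ends in $S$ is isomorphic to $H$. For a directed graph $H$ on $h$ vertices, $\pi_H(\emptyset)=\lim_{n\to\infty}\max_D e_H(D)/\binom{n}{h}$, where the maximum is over directed graphs $D$ on $n$ vertices and $e_H(D)$ counts the $h$-subsets of $V(D)$ inducing a copy of $H$ (the limit exists). *)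

(* Defs.v *)
From HB Require Import structures.
From mathcomp Require Import all_boot all_order all_algebra.
From mathcomp Require Import all_classical all_reals all_analysis.

Set Implicit Arguments.
Unset Strict Implicit.
Unset Printing Implicit Defensive.

Import Order.TTheory GRing.Theory Num.Theory.
Import numFieldNormedType.Exports.

Local Open Scope ring_scope.

Definition loopless (V : finType) (E : {set V * V}) : bool :=
  [forall x, (x, x) \notin E].

(* Both (x, y) and (y, x) may be arcs: only loops are excluded. *)
Record digraph (V : finType) := Digraph {
  arcs : {set V * V};
  arcs_loopless : loopless arcs }.

HB.instance Definition _ (V : finType) := [isSub for @arcs V].
HB.instance Definition _ (V : finType) := [Finite of digraph V by <:].

Definition isomorphic (V W : finType) (D : digraph V) (H : digraph W) : bool :=
  [exists f : {ffun V -> W},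
    [&& injectiveb f,
        [forall w, exists v, f v == w] &
        [forall x, forall y,
          ((x, y) \in arcs D) == ((f x, f y) \in arcs H)]]].

Section Induced.
Variables (V : finType) (D : digraph V) (S : {set V}).

Definition induced_arcs : {set {x : V | x \in S} * {x : V | x \in S}} :=
  [set p | (val p.1, val p.2) \in arcs D].

Fact induced_arcs_loopless : loopless induced_arcs.
Proof.
apply/forallP => x; rewrite inE /=.
exact: (forallP (arcs_loopless D) (val x)).
Qed.

Definition induced : digraph {x : V | x \in S} :=
  Digraph induced_arcs_loopless.

End Induced.

Definition induced_count (V W : finType) (H : digraph W) (D : digraph V) : nat :=
  #|[set S : {set V} | (#|S| == #|W|) && isomorphic (induced D S) H]|.

Definition max_induced_count (W : finType) (H : digraph W) (n : nat) : nat :=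
  \max_(D : digraph 'I_n) induced_count H D.

(* The limit of this sequence is pi_H(emptyset); the value is 0 when n < #|W|. *)
Definition max_induced_density (R : realType) (W : finType) (H : digraph W)
    (n : nat) : R :=
  (max_induced_count H n)%:R / ('C(n, #|W|))%:R.

(* The vertices 1, 2, 3 are the elements 0, 1, 2 of 'I_3. *)
Definition S3_arcs : {set 'I_3 * 'I_3} :=
  [set (inord 0, inord 1); (inord 0, inord 2)].

Fact S3_arcs_loopless : loopless S3_arcs.
Proof.
apply/forallP => x; rewrite !inE !xpair_eqE.
by apply/negP => /orP[] /andP[/eqP -> /eqP/(congr1 val)]; rewrite /= !inordK.
Qed.

Definition S3 : digraph 'I_3 := Digraph S3_arcs_loopless.

(* Main.v *)
(* Put k = 2 / sqrt 3 - 1, so that 3 k = 2 sqrt 3 - 3 and 3 k^2 + 6 k = 1, and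
   count induced stars by ordered triples (centre, leaf, leaf), two per copy.

   Upper bound: give the vertices real weights and consider the cubic form
   summing w c * w x * w y over the stars, where the leaves may coincide. Along
   a transfer of weight between two nonadjacent vertices it is a convex quadratic,
   so one of the two can be emptied. When the support is a tournament, each pair
   {c, x} contributes w c * (w x)^2 for its arc c -> x, so the heaviest vertex, of
   weight a, contributes at most a^2 (s - a), s being the total weight; by
   induction the form is at most a^2 (s - a) + k (s - a)^3 <= k s^3.

   Lower bound: adding a sinks dominated by all m old vertices creates m a (a - 1)
   new ordered stars; taking a close to the maximiser of the same recursion gives
   k n^3 - O(n^2). *)
Require Import Defs.
From HB Require Import structures.
From mathcomp Require Import all_boot all_order all_algebra.
From mathcomp Require Import all_classical all_reals all_analysis.
From mathcomp Require Import ring lra.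

Set Implicit Arguments.
Unset Strict Implicit.
Unset Printing Implicit Defensive.

Import Order.TTheory GRing.Theory Num.Theory.
Import numFieldNormedType.Exports.

Local Open Scope ring_scope.

(** * Induced copies of [S3] as ordered stars *)

Section InducedStars.
Variables (V : finType) (D : digraph V).

(** Every arc among the three vertices is prescribed, since opposite arcs may coexist; that [c]
    differs from the leaves follows from looplessness. *)
Definition is_star (c x y : V) : bool :=
  [&& (c, x) \in arcs D, (c, y) \in arcs D, (x, c) \notin arcs D,
      (y, c) \notin arcs D, (x, y) \notin arcs D, (y, x) \notin arcs D & x != y].

Definition star_count : nat :=
  (\sum_(c : V) \sum_(x : V) \sum_(y : V) is_star c x y)%N.

Lemma arcs_irrefl (x : V) : (x, x) \notin arcs D.
Proof. exact: (forallP (arcs_loopless D) x). Qed.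

Lemma is_star_neq (c x y : V) : is_star c x y -> [/\ c != x, c != y & x != y].
Proof.
case/and5P => cx cy _ _ /and3P[_ _ xy]; split => //.
  by apply/negP => /eqP e; move: (arcs_irrefl x); rewrite -{1}e cx.
by apply/negP => /eqP e; move: (arcs_irrefl y); rewrite -{1}e cy.
Qed.

Lemma mem_S3_arcs (i j : 'I_3) :
  ((i, j) \in arcs S3) = (i == inord 0) && (j != inord 0).
Proof.
rewrite /= /S3_arcs !inE !xpair_eqE -!val_eqE /= !inordK //.
by case: i => [[|[|[|i]]] hi]; case: j => [[|[|[|j]]] hj].
Qed.

Lemma induces_S3P (S : {set V}) :
  reflect (exists c x y, is_star c x y /\ S = [set c; x; y])
          ((#|S| == #|'I_3|) && isomorphic (Defs.induced D S) S3).
Proof.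
apply: (iffP andP) => [[_ /existsP[f /and3P[/injectiveP f_inj f_surj f_arc]]]|].
  have f_onto i : exists z, f z = i.
    by have /existsP[z /eqP] := forallP f_surj i; exists z.
  have [c fc] := f_onto (inord 0); have [x fx] := f_onto (inord 1).
  have [y fy] := f_onto (inord 2).
  have arcE (z t : {x : V | x \in S}) :
      ((val z, val t) \in arcs D) = (f z == inord 0) && (f t != inord 0).
    have /forallP/(_ t)/eqP := forallP f_arc z.
    by rewrite mem_S3_arcs inE.
  exists (val c), (val x), (val y); split.
    rewrite /is_star !arcE fc fx fy -!val_eqE /= !inordK //=.
    apply/negP => /eqP/val_inj xy; move: fy; rewrite -xy fx.
    by move/(congr1 val); rewrite /= !inordK.
  apply/setP => z; rewrite !inE; apply/idP/idP => [zS|]; last first.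
    by move=> /orP[/orP[]|] /eqP ->; apply: valP.
  have [e|e|e] : [\/ f (exist _ z zS) = inord 0, f (exist _ z zS) = inord 1
                   | f (exist _ z zS) = inord 2].
    case: (f _) => -[|[|[|//]]] hi; [constructor 1|constructor 2|constructor 3];
    by apply/val_inj; rewrite /= inordK.
  - by move: e; rewrite -fc => /f_inj/(congr1 val) /= ->; rewrite eqxx.
  - by move: e; rewrite -fx => /f_inj/(congr1 val) /= ->; rewrite eqxx orbT.
  - by move: e; rewrite -fy => /f_inj/(congr1 val) /= ->; rewrite eqxx orbT.
move=> [c [x [y [st ->]]]]; have [cx cy xy] := is_star_neq st.
split; first by rewrite card_ord -finset.setUA cardsU1 cards2 xy !inE negb_or cx cy.
set T := [set c; x; y].
have cT : c \in T by rewrite !inE eqxx.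
have xT : x \in T by rewrite !inE eqxx orbT.
have yT : y \in T by rewrite !inE eqxx orbT.
pose g (z : V) : 'I_3 :=
  if z == c then inord 0 else if z == x then inord 1 else inord 2.
have gc : g c = inord 0 by rewrite /g eqxx.
have gx : g x = inord 1 by rewrite /g eqxx eq_sym (negbTE cx).
have gy : g y = inord 2.
  by rewrite /g eq_sym (negbTE cy) eq_sym (negbTE xy).
have inT (z : V) : z \in T -> [\/ z = c, z = x | z = y].
  by rewrite !inE => /orP[/orP[]|] /eqP ->;
    [constructor 1|constructor 2|constructor 3].
have ordE : ((inord 0 : 'I_3) == inord 1 = false) *
   ((inord 0 : 'I_3) == inord 2 = false) * ((inord 1 : 'I_3) == inord 2 = false) *
   ((inord 1 : 'I_3) == inord 0 = false) * ((inord 2 : 'I_3) == inord 0 = false) *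
   ((inord 2 : 'I_3) == inord 1 = false).
  by rewrite -!val_eqE /= !inordK.
apply/existsP; exists [ffun z => g (val z)]; apply/and3P; split.
- apply/injectiveP => -[z zT] [t tT]; rewrite !ffunE /= => e; apply/val_inj => /=.
  by case: (inT _ zT) e => ->; case: (inT _ tT) => -> //;
    rewrite ?gc ?gx ?gy => /eqP; rewrite ordE.
- apply/forallP => i; apply/existsP.
  have [->|->|->] : [\/ i = inord 0, i = inord 1 | i = inord 2].
    case: i => -[|[|[|//]]] hi; [constructor 1|constructor 2|constructor 3];
    by apply/val_inj; rewrite /= inordK.
  + by exists (exist _ c cT); rewrite ffunE /= gc.
  + by exists (exist _ x xT); rewrite ffunE /= gx.
  + by exists (exist _ y yT); rewrite ffunE /= gy.
- apply/forallP => -[z zT]; apply/forallP => -[t tT].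
  rewrite !ffunE mem_S3_arcs inE /=.
  case/and5P: st => h1 h2 /negbTE h3 /negbTE h4 /and3P[/negbTE h5 /negbTE h6 _].
  have irr a : ((a, a) \in arcs D) = false by apply/negbTE/arcs_irrefl.
  by case: (inT _ zT) => ->; case: (inT _ tT) => ->;
    rewrite ?gc ?gx ?gy ?eqxx ?ordE ?h1 ?h2 ?h3 ?h4 ?h5 ?h6 ?irr.
Qed.

Lemma is_star_sym (c x y : V) : is_star c x y = is_star c y x.
Proof.
rewrite /is_star (eq_sym y x).
by do !case: (_ \in arcs D) => //=.
Qed.

(** The centre is the only vertex of the triple with an outgoing arc inside it, so the vertex set
    fixes the centre and leaves only the order of the leaves free. *)
Lemma is_star_unique (c x y c' x' y' : V) :
  is_star c x y -> is_star c' x' y' -> [set c; x; y] = [set c'; x'; y'] ->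
  c' = c /\ (x', y') \in [set (x, y); (y, x)].
Proof.
move=> st st' e; have [cx cy xy] := is_star_neq st.
have [cx' cy' xy'] := is_star_neq st'.
have in3 (z : V) : z \in [set c'; x'; y'] -> [\/ z = c, z = x | z = y].
  by rewrite -e !inE => /orP[/orP[]|] /eqP ->;
    [constructor 1|constructor 2|constructor 3].
case/and5P: st => h1 h2 /negbTE h3 /negbTE h4 /and3P[/negbTE h5 /negbTE h6 _].
case/and5P: st' => k1 k2 _ _ _.
have irr a : ((a, a) \in arcs D) = false by apply/negbTE/arcs_irrefl.
have c'E : c' = c.
  have c'in : c' \in [set c'; x'; y'] by rewrite !inE eqxx.
  have x'in : x' \in [set c'; x'; y'] by rewrite !inE eqxx orbT.
  case: (in3 _ c'in) => // e1; case: (in3 _ x'in) => e2;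
  by move: k1; rewrite e1 e2 ?irr ?h3 ?h4 ?h5 ?h6.
split => //; rewrite !inE !xpair_eqE.
have [|xc|xx|xx] := in3 x'; first by rewrite !inE eqxx orbT.
- by rewrite xc c'E eqxx in cx'.
- have [|yc|yx|->] := in3 y'; first by rewrite !inE eqxx orbT.
  + by rewrite yc c'E eqxx in cy'.
  + by rewrite xx yx eqxx in xy'.
  + by rewrite xx !eqxx.
- have [|yc|->|yx] := in3 y'; first by rewrite !inE eqxx orbT.
  + by rewrite yc c'E eqxx in cy'.
  + by rewrite xx !eqxx orbT.
  + by rewrite xx yx eqxx in xy'.
Qed.

Lemma star_countE : star_count = (2 * induced_count S3 D)%N.
Proof.
pose stars := [set t : V * (V * V) | is_star t.1 t.2.1 t.2.2].
pose span (t : V * (V * V)) := [set t.1; t.2.1; t.2.2].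
have -> : star_count = #|stars|.
  rewrite /star_count -sum1_card [RHS]big_mkcond /=.
  under eq_bigr => c _ do
    rewrite (pair_bigA _ (fun x y => nat_of_bool (is_star c x y))) /=.
  rewrite (pair_bigA _ (fun c p => nat_of_bool (is_star c p.1 p.2))) /=.
  by apply: eq_bigr => t _; rewrite inE; case: is_star.
rewrite /induced_count; set sets := [set S | _].
(* Ordered stars are grouped by vertex set; each fibre consists of the two orders of the leaves. *)
rewrite -sum1_card (partition_big span (mem sets)) /=; last first.
  move=> [c [x y]]; rewrite !inE /= => st; apply/induces_S3P.
  by exists c, x, y.
rewrite mulnC -sum_nat_const; apply: eq_bigr => S.
rewrite inE => /induces_S3P[c [x [y [st ->]]]].
have [_ _ xy] := is_star_neq st.
rewrite sum1dep_card.
rewrite (_ : [set _ | _] = [set (c, (x, y)); (c, (y, x))]).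
  by rewrite cards2 !xpair_eqE eqxx /= (negbTE xy).
apply/setP => -[c' [x' y']]; rewrite !inE /span /=; apply/andP/idP.
  move=> [st' /eqP e]; have [-> ] := is_star_unique st st' (esym e).
  by rewrite !inE !xpair_eqE eqxx.
move=> /orP[] /eqP[-> -> ->]; first by split.
by rewrite -is_star_sym; split => //; rewrite -!finset.setUA (finset.setUC [set x]).
Qed.

End InducedStars.

(** * The cubic form on weighted vertices and its maximum *)

Section StarForm.
Variables (R : realFieldType) (V : finType) (p : rel V).
Hypothesis p_asym : forall x y, p x y -> ~~ p y x.

Definition nonadjacent (x y : V) : bool := ~~ p x y && ~~ p y x.

(* Leaves may coincide, so that in a blow-up with part sizes [w] this counts
   the induced stars up to lower order terms. *)
Definition weak_star (c x y : V) : bool := [&& p c x, p c y & nonadjacent x y].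

Definition star_form (w : V -> R) : R :=
  \sum_(c : V) \sum_(x : V) \sum_(y : V) (weak_star c x y)%:R * (w c * w x * w y).

Lemma rel_irrefl (x : V) : p x x = false.
Proof. by apply/negP => pxx; move: (p_asym pxx); rewrite pxx. Qed.

(** The direction [d] of the transfer is supported on [u] and [v], so [d x * d y] vanishes along
    every arc. This kills the cubic term and the quadratic terms that involve the centre; what
    remains is a nonnegative combination of squares. *)
Lemma star_form_shift (u v : V) (w : V -> R) :
  nonadjacent u v -> (forall x, 0 <= w x) ->
  exists2 k : R, 0 <= k & exists a b, forall t,
    star_form (fun x => w x + t * ((x == u)%:R - (x == v)%:R)) =
    a + b * t + k * t ^+ 2.
Proof.
move=> /andP[/negbTE uv /negbTE vu] w0.
pose d (x : V) : R := (x == u)%:R - (x == v)%:R.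
have dd (x y : V) : p x y -> d x * d y = 0.
  rewrite /d => xy.
  case: (eqVneq x u) => [xu|_]; case: (eqVneq x v) => [xv|_];
  case: (eqVneq y u) => [yu|_]; case: (eqVneq y v) => [yv|_];
  rewrite ?subrr ?mulr0 ?mul0r //; by subst; rewrite ?uv ?vu ?rel_irrefl in xy.
have dd' (x y : V) : d x * d y * (nonadjacent x y)%:R = d x * d y.
  case: (boolP (nonadjacent x y)) => [_|]; first by rewrite mulr1.
  by rewrite /nonadjacent negb_and !negbK mulr0 => /orP[] /dd // ; rewrite mulrC.
pose S3sum (F : V -> V -> V -> R) := \sum_c \sum_x \sum_y F c x y.
exists (\sum_c w c * (\sum_x d x * (p c x)%:R) ^+ 2).
  by apply: sumr_ge0 => c _; rewrite mulr_ge0 ?sqr_ge0.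
exists (S3sum (fun c x y => (weak_star c x y)%:R * (w c * w x * w y))).
exists (S3sum (fun c x y => (weak_star c x y)%:R *
   (d c * w x * w y + w c * d x * w y + w c * w x * d y))).
move=> t; rewrite /star_form /S3sum !mulr_suml -!big_split; apply: eq_bigr => c _ /=.
have -> : w c * (\sum_x d x * (p c x)%:R) ^+ 2 * t ^+ 2 =
    \sum_x \sum_y (weak_star c x y)%:R * (w c * d x * d y) * t ^+ 2.
  rewrite [in X in _ * X * _]expr2 mulr_suml mulr_sumr mulr_suml; apply: eq_bigr => x _.
  rewrite !mulr_sumr mulr_suml; apply: eq_bigr => y _.
  have := dd' x y; rewrite /weak_star -[w c * d x * d y]mulrA => <-.
  rewrite (_ : w c * _ = w c * (d x * d y) * ((p c x)%:R * (p c y)%:R)); last by ring.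
  rewrite -[in LHS]dd'.
  by case: (p c x); case: (p c y); case: nonadjacent => /=; ring.
rewrite mulr_suml -!big_split; apply: eq_bigr => x _ /=.
rewrite mulr_suml -!big_split; apply: eq_bigr => y _ /=.
rewrite -/(d c) -/(d x) -/(d y).
case: (boolP (weak_star c x y)) => [/and3P[cx cy _]|_]; last by rewrite /=; ring.
have e1 := dd _ _ cx; have e2 := dd _ _ cy; rewrite !mul1r.
transitivity (w c * w x * w y + (d c * w x * w y + w c * d x * w y + w c * w x * d y) * t
 + w c * d x * d y * t ^+ 2 + t ^+ 2 * ((d c * d x) * w y + (d c * d y) * w x)
 + t ^+ 3 * (d c * d x) * d y); first by ring.
by rewrite e1 e2; ring.
Qed.

Lemma convex_quadratic_max (a b k s t : R) :
  0 <= k -> 0 <= t <= s ->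
  a + b * t + k * t ^+ 2 <= a \/ a + b * t + k * t ^+ 2 <= a + b * s + k * s ^+ 2.
Proof.
move=> k0 /andP[t0 ts].
(* The increment from 0 to [t] is [t * (b + k * t)]; the sign of the second factor decides which
   endpoint wins. *)
have [h|h] := lerP (b + k * t) 0; [left|right].
  by rewrite -addrA gerDl expr2 mulrA -mulrDl mulr_le0_ge0.
rewrite -!addrA lerD2l !expr2 !mulrA -!mulrDl.
have h' : 0 <= k * (s - t) by rewrite mulr_ge0 // subr_ge0.
apply: ler_pM => //; [exact: ltW|nra].
Qed.

(* The hypothesis on [k] says that the discriminant of
   [(k + 1) a^2 - (3 k + 1) a s + 3 k s^2] vanishes. *)
Lemma star_recursion_bound (k a s : R) :
  0 <= k -> 3 * k ^+ 2 + 6 * k = 1 -> 0 <= a ->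
  a ^+ 2 * (s - a) + k * (s - a) ^+ 3 <= k * s ^+ 3.
Proof.
move=> k0 kE a0; rewrite -subr_ge0.
have k1 : 0 < k + 1 by lra.
rewrite -(pmulr_rge0 _ (_ : 0 < 4 * (k + 1))); last by lra.
have -> : 4 * (k + 1) * (k * s ^+ 3 - (a ^+ 2 * (s - a) + k * (s - a) ^+ 3)) =
    a * (2 * (k + 1) * a - (3 * k + 1) * s) ^+ 2
    - a * s ^+ 2 * (1 - (3 * k ^+ 2 + 6 * k)) by ring.
by rewrite kE subrr mulr0 subr0 mulr_ge0 // sqr_ge0.
Qed.

(** Two leaves of nonzero weight both lie in [A], so being nonadjacent forces them to coincide. *)
Lemma star_form_tournament (w : V -> R) (A : {set V}) :
  (forall x, x \notin A -> w x = 0) ->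
  {in A &, forall x y, x != y -> ~~ nonadjacent x y} ->
  star_form w = \sum_c \sum_x (p c x)%:R * (w c * w x ^+ 2).
Proof.
move=> wA tour; apply: eq_bigr => c _; apply: eq_bigr => x _.
rewrite (bigD1 x) //= big1 ?addr0.
  by rewrite /weak_star /nonadjacent rel_irrefl /= andbT andbb expr2 -mulrA.
move=> y yx.
have [xA|/wA->] := boolP (x \in A); last by rewrite !(mulr0, mul0r).
have [yA|/wA->] := boolP (y \in A); last by rewrite !(mulr0, mul0r).
by rewrite /weak_star eq_sym in yx *; rewrite (negbTE (tour _ _ xA yA yx)) !andbF mul0r.
Qed.

Lemma star_form_remove_max (w : V -> R) (A : {set V}) (m : V) :
  (forall x, 0 <= w x) -> (forall x, w x <= w m) ->
  (forall x, x \notin A -> w x = 0) ->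
  {in A &, forall x y, x != y -> ~~ nonadjacent x y} ->
  star_form w <= w m ^+ 2 * (\sum_(x | x != m) w x)
     + star_form (fun x => if x == m then 0 else w x).
Proof.
move=> w0 wm wA tour; rewrite (star_form_tournament wA tour).
rewrite (@star_form_tournament (fun x => if x == m then 0 else w x) A) //; last first.
  by move=> x /wA ->; rewrite if_same.
rewrite (bigD1 m) //= [X in _ <= _ + X](bigD1 m) //= eqxx.
rewrite [X in _ <= _ + (X + _)]big1 ?add0r; last by move=> x _; rewrite mul0r mulr0.
rewrite (bigD1 m) //= rel_irrefl mul0r add0r mulr_sumr.
under [X in _ + X <= _]eq_bigr => c _ do rewrite (bigD1 m) //=.
rewrite big_split /= addrA; apply: lerD.
  rewrite -big_split /=; apply: ler_sum => x _.
  (* As [w m] is maximal, the pair of [m] and [x] contributes at most [w m ^+ 2 * w x], whichever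
     way its arc points. *)
  have h : w m * w x ^+ 2 <= w m ^+ 2 * w x.
    rewrite -subr_ge0.
    have -> : w m ^+ 2 * w x - w m * w x ^+ 2 = w m * w x * (w m - w x) by ring.
    by rewrite !mulr_ge0 // subr_ge0.
  have := p_asym (x := m) (y := x).
  case: (p m x) => [/(_ isT)/negbTE ->|_]; first by rewrite mul0r addr0 mul1r.
  by case: (p x m); rewrite ?mul0r ?mul1r ?add0r ?addr0 ?mulr_ge0 ?sqr_ge0 // mulrC.
apply: ler_sum => c /negbTE cm; rewrite cm [X in _ <= X](bigD1 m) //= eqxx.
rewrite expr0n /= !mulr0 add0r.
by apply: ler_sum => x /negbTE ->.
Qed.

Lemma star_form_bound (k : R) (w : V -> R) :
  0 <= k -> 3 * k ^+ 2 + 6 * k = 1 -> (forall x, 0 <= w x) ->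
  star_form w <= k * (\sum_x w x) ^+ 3.
Proof.
move=> k0 kE.
(* Induction on the size of the support, for all weightings at once. *)
have [n] := ubnP #|[set x | w x != 0]|; elim: n w => // n IH w.
rewrite ltnS => wn w0; set A := [set x | w x != 0] in wn *.
have wA x : x \notin A -> w x = 0 by rewrite inE negbK => /eqP.
have [/existsP[u /existsP[v /and4P[uA vA uv nuv]]]|tour] :=
  boolP [exists u, exists v, [&& u \in A, v \in A, u != v & nonadjacent u v]].
  pose s := w u + w v.
  (* [q] moves all the weight of [u] to [v], so the parameter [t] of the transfer is the new weight
     of [u]: [w u] gives back [w], while 0 and [s] empty [u] and [v] respectively. *)
  pose q x := if x == u then 0 else if x == v then s else w x.
  have q0 x : 0 <= q x by rewrite /q; do 2!case: ifP => _ //; rewrite addr_ge0.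
  have [kk kk0 [a [b fE]]] := star_form_shift nuv q0.
  have := uv; rewrite eq_sym => vu.
  have shiftE t x : q x + t * ((x == u)%:R - (x == v)%:R) =
     if x == u then t else if x == v then s - t else w x.
    rewrite /q; case: eqVneq => [->|_].
      by rewrite (negbTE uv) subr0 mulr1 add0r.
    by case: eqVneq => _; rewrite ?subr0 ?mulr0 ?addr0 // sub0r mulrN1.
  have sumE t : \sum_x (q x + t * ((x == u)%:R - (x == v)%:R)) = \sum_x w x.
    under eq_bigr do rewrite shiftE.
    rewrite (bigD1 u) //= eqxx (bigD1 v) //= (negbTE vu) eqxx.
    rewrite [RHS](bigD1 u) //= [X in _ = _ + X](bigD1 v) //= !addrA.
    congr (_ + _); first by rewrite /s; ring.
    by apply: eq_bigr => x /andP[/negbTE-> /negbTE->].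
  have wE : star_form w = a + b * w u + kk * w u ^+ 2.
    rewrite -fE; congr star_form; apply/funext => x; rewrite shiftE.
    by case: eqVneq => [->//|_]; case: eqVneq => [->|//]; rewrite /s addrC addKr.
  (* [z] is the vertex emptied by the transfer; losing it makes the support strictly smaller, as the
     induction requires. *)
  have bnd t z : 0 <= t <= s -> z \in A ->
     (if z == u then t else if z == v then s - t else w z) = 0 ->
     a + b * t + kk * t ^+ 2 <= k * (\sum_x w x) ^+ 3.
    move=> /andP[t0 ts] zA zt; rewrite -fE -(sumE t); apply: IH; last first.
      by move=> x; rewrite shiftE; do 2!case: ifP => _ //; rewrite subr_ge0.
    apply: leq_trans wn; apply: proper_card; apply/properP; split.
      apply/fintype.subsetP => x; rewrite inE shiftE.
      by case: (eqVneq x u) => [->//|_]; case: (eqVneq x v) => [->//|_]; rewrite inE.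
    by exists z => //; rewrite inE shiftE zt eqxx.
  have s0 : 0 <= s by rewrite addr_ge0.
  have us : 0 <= w u <= s by rewrite w0 lerDl w0.
  rewrite wE; have [h|h] := convex_quadratic_max a b kk0 us; apply: le_trans h _.
    have := bnd 0 u; rewrite expr0n /= !mulr0 !addr0; apply; rewrite ?lexx ?eqxx //.
  by apply: (bnd s v); rewrite ?lexx ?s0 // (negbTE vu) eqxx subrr.
have {}tour : {in A &, forall x y, x != y -> ~~ nonadjacent x y}.
  move=> x y xA yA xy; apply: contra tour => nxy.
  by apply/existsP; exists x; apply/existsP; exists y; rewrite xA yA xy.
have sum0 : 0 <= \sum_x w x by rewrite sumr_ge0.
have [A0|[m0 m0A]] := set_0Vmem A.
  rewrite /star_form big1 ?mulr_ge0 ?exprn_ge0 // => c _; rewrite big1 // => x _.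
  by rewrite big1 // => y _; rewrite (wA y) ?A0 ?inE // !mulr0.
have [m _ wm] : exists2 m, true & forall x, w x <= w m.
  by have [//|m _ h] := @Order.TotalTheory.arg_maxP _ R V m0 xpredT w;
    exists m => // x; apply: h.
have mA : m \in A.
  rewrite inE; move: m0A; rewrite inE; apply: contra => /eqP m_0.
  by rewrite eq_le w0 andbT -m_0.
apply: le_trans (star_form_remove_max w0 wm wA tour) _.
pose w' x := if x == m then 0 else w x; rewrite -/w'.
have sum' : \sum_x w' x = \sum_(x | x != m) w x.
  rewrite (bigD1 m) //= /w' eqxx add0r.
  by apply: eq_bigr => x /negbTE->.
have sE : \sum_(x | x != m) w x = \sum_x w x - w m.
  by rewrite [X in X - _](bigD1 m) //= [RHS]addrC addKr.
apply: le_trans (_ : _ <= w m ^+ 2 * (\sum_x w x - w m) + k * (\sum_x w x - w m) ^+ 3) _.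
  rewrite sE lerD2l -sE -sum'; apply: IH; last first.
    by move=> x; rewrite /w'; case: ifP.
  apply: leq_trans wn; apply: proper_card; apply/properP; split.
    by apply/fintype.subsetP => x; rewrite !inE /w'; case: ifP; rewrite ?eqxx.
  by exists m; rewrite // inE /w' !eqxx.
exact: star_recursion_bound.
Qed.

End StarForm.

(** The form is taken at unit weights. The relation [p] drops pairs of opposite arcs, which makes it
    asymmetric; no induced star contains such a pair, and extra weak stars are harmless for an upper
    bound. *)
Lemma star_count_upper (R : realFieldType) (k : R) (V : finType) (D : digraph V) :
  0 <= k -> 3 * k ^+ 2 + 6 * k = 1 ->
  (star_count D)%:R <= k * #|V|%:R ^+ 3.
Proof.
move=> k0 kE; pose p := [rel x y | ((x, y) \in arcs D) && ((y, x) \notin arcs D)].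
have p_asym x y : p x y -> ~~ p y x.
  by move=> /andP[xy _]; rewrite /= negb_and negbK xy orbT.
have := star_form_bound p_asym k0 kE (fun _ : V => @ler01 R).
rewrite sumr_const; apply: le_trans.
rewrite /star_count natr_sum; apply: ler_sum => c _.
rewrite natr_sum; apply: ler_sum => x _.
rewrite natr_sum; apply: ler_sum => y _.
rewrite !mulr1 ler_nat; case: (boolP (is_star D c x y)) => //.
case/and5P => cx cy xc yc /and3P[xy yx _].
by rewrite /weak_star /nonadjacent /= cx cy xc yc (negbTE xy) (negbTE yx).
Qed.

(** * Lower bound by adding dominated sinks *)

Section AddSinks.
Variables (m a : nat) (D : digraph 'I_m).

Definition add_sinks_arcs : {set 'I_(m + a) * 'I_(m + a)} :=
  [set e | match fintype.split e.1, fintype.split e.2 with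
           | inl i, inl j => (i, j) \in arcs D
           | inl _, inr _ => true
           | inr _, _ => false
           end].

Fact add_sinks_arcs_loopless : loopless add_sinks_arcs.
Proof.
apply/forallP => x; rewrite inE /=; case: (fintype.split x) => // i.
exact: arcs_irrefl.
Qed.

Definition add_sinks : digraph 'I_(m + a) := Digraph add_sinks_arcs_loopless.

(** Only old centres are counted, with leaves both old or both new; discarding the other triples is
    harmless for a lower bound. *)
Lemma star_count_add_sinks : (star_count D + m * (a * a.-1) <= star_count add_sinks)%N.
Proof.
have splitl (i : 'I_m) : fintype.split (lshift a i) = inl i.
  exact: (unsplitK (inl i)).
have splitr (j : 'I_a) : fintype.split (rshift m j) = inr j.
  exact: (unsplitK (inr j)).
rewrite /star_count big_split_ord /=; apply: leq_trans (leq_addr _ _).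
rewrite -[X in (_ + X * _)%N](card_ord m) -sum_nat_const -big_split /=.
apply: leq_sum => c _; rewrite big_split_ord /=; apply: leq_add.
  apply: leq_sum => x _; rewrite big_split_ord /=; apply: leq_trans (leq_addr _ _).
  apply: leq_sum => y _.
  by rewrite /is_star /= !inE /= !splitl (inj_eq (@lshift_inj _ _)).
rewrite -[X in (X * _)%N](card_ord a) -sum_nat_const.
apply: leq_sum => x _; rewrite big_split_ord /=; apply: leq_trans (leq_addl _ _).
rewrite (bigD1 x) //= (eq_bigr (fun=> 1%N)) => [|y yx].
  rewrite sum1_card; apply: leq_trans (leq_addl _ _).
  by rewrite cardC1 card_ord.
rewrite /is_star /= !inE /= !splitl !splitr /= (inj_eq (@rshift_inj _ _)).
by rewrite eq_sym yx.
Qed.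

End AddSinks.

Lemma max_induced_count_attained (W : finType) (H : digraph W) (n : nat) :
  exists D : digraph 'I_n, max_induced_count H n = induced_count H D.
Proof.
have empty : @loopless 'I_n finset.set0 by apply/forallP => x; rewrite inE.
have [|D eD] := bigop.eq_bigmax (fun D : digraph 'I_n => induced_count H D).
  by apply/card_gt0P; exists (Digraph empty).
by exists D.
Qed.

Lemma max_star_count_add_sinks (m a : nat) :
  (2 * max_induced_count S3 m + m * (a * a.-1) <= 2 * max_induced_count S3 (m + a))%N.
Proof.
have [D ->] := max_induced_count_attained S3 m.
rewrite -star_countE; apply: leq_trans (star_count_add_sinks a D) _.
by rewrite star_countE leq_mul2l /=; apply: leq_bigmax.
Qed.

Lemma max_star_count_upper (R : realFieldType) (k : R) (n : nat) :
  0 <= k -> 3 * k ^+ 2 + 6 * k = 1 ->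
  (2 * max_induced_count S3 n)%:R <= k * n%:R ^+ 3.
Proof.
move=> k0 kE; have [D ->] := max_induced_count_attained S3 n.
by have := star_count_upper D k0 kE; rewrite star_countE card_ord.
Qed.

(* The optimal number of new independent vertices is [(3 k + 1) / (2 (k + 1)) n],
   the double root of the quadratic in [star_recursion_bound]. *)
Lemma max_star_count_lower (R : archiRealFieldType) (k : R) (n : nat) :
  0 <= k -> 3 * k ^+ 2 + 6 * k = 1 ->
  k * n%:R ^+ 3 - 2 * n%:R ^+ 2 <= (2 * max_induced_count S3 n)%:R.
Proof.
move=> k0 kE.
have kl : 1 / 8 <= k by nra.
have ku : k <= 1 / 6 by nra.
have [N] := ubnP n; elim: N n => // N IH n; rewrite ltnS => nN.
have [n1|n2] := leqP n 1.
  apply: le_trans (ler0n _ _); case: n n1 {nN} => [|[|//]] _.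
    by rewrite !expr0n /= !mulr0 subr0.
  by rewrite !expr1n !mulr1; lra.
set al := (3 * k + 1) / (2 * (k + 1)).
have alE : al * (2 * (k + 1)) = 3 * k + 1 by rewrite mulfVK //; lra.
(* Since [al] is a double root, its square is the product [3 * k / (k + 1)] of the roots. *)
have al2E : (k + 1) * al ^+ 2 = 3 * k.
  apply: (@mulfI _ (4 * (k + 1))); first by apply/negP => /eqP; lra.
  have -> : 4 * (k + 1) * ((k + 1) * al ^+ 2) = (al * (2 * (k + 1))) ^+ 2 by ring.
  by rewrite alE; lra.
(* For [n] at least 2 these two bounds on [al] give [0 < a < n], so the induction hypothesis applies
   to [m]. *)
have al0 : 1 / 2 <= al by nra.
have al1 : al < 1 by nra.
have n2R : 2 <= n%:R :> R by rewrite (ler_nat R 2).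
set z := al * n%:R.
have z0 : 0 <= z by apply: mulr_ge0 => //; lra.
have /andP[az za] := truncn_itv z0; set a := Num.trunc z in az za.
have a0 : (0 < a)%N.
  rewrite -(ltr_nat R) /=; rewrite -natr1 in za; rewrite /z in za; nra.
have an : (a < n)%N.
  by rewrite -(ltr_nat R); apply: le_lt_trans az _; rewrite /z; nra.
pose m := (n - a)%N.
have nE : n = (m + a)%N by rewrite /m subnK // ltnW.
have mN : (m < N)%N.
  by apply: leq_trans nN; rewrite /m ltn_subrL a0 (leq_trans _ n2).
have := max_star_count_add_sinks m a; rewrite -nE -(ler_nat R).
apply: le_trans; rewrite natrD (natrM _ m) (natrM _ a).
apply: le_trans (lerD (IH m mN) (lexx _)).
have mR : m%:R = n%:R - a%:R :> R by rewrite /m natrB // ltnW.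
have -> : a.-1%:R = a%:R - 1 :> R by rewrite -[in RHS](prednK a0) -natr1 addrK.
rewrite mR.
move: za az; rewrite -natr1; set x : R := a%:R; set y : R := n%:R => za az.
have x1 : 1 <= x by rewrite (ler_nat R 1).
have xy : x <= y by rewrite ler_nat ltnW.
rewrite -subr_ge0.
(* Up to the factor [x], rounding [z] down to [x] costs only [(k + 1) * (z - x) ^+ 2], because the
   root is double, and using [x * (x - 1)] instead of [x ^+ 2] costs [y - x]. Both are paid for by
   the decrease of the quadratic error term from [y] to [y - x]. *)
have -> : k * (y - x) ^+ 3 - 2 * (y - x) ^+ 2 + (y - x) * (x * (x - 1))
   - (k * y ^+ 3 - 2 * y ^+ 2) =
   x * (2 * (y + (y - x)) - (y - x) - (k + 1) * (z - x) ^+ 2).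
  have -> : (k + 1) * (z - x) ^+ 2 =
      (k + 1) * x ^+ 2 - al * (2 * (k + 1)) * x * y + (k + 1) * al ^+ 2 * y ^+ 2.
    by rewrite /z -/y; ring.
  by rewrite alE al2E; ring.
apply: mulr_ge0; first lra.
have : (z - x) ^+ 2 <= 1 by rewrite expr_le1 //; lra.
nra.
Qed.

(** * Normalisation by the binomial coefficient, and the limit *)

Lemma max_induced_density_S3_close (R : realType) (k : R) (n : nat) :
  0 <= k -> 3 * k ^+ 2 + 6 * k = 1 -> (4 <= n)%N ->
  3 * k - 20 * harmonic n <= max_induced_density R S3 n <= 3 * k + 20 * harmonic n.
Proof.
move=> k0 kE n4.
have := max_star_count_lower n k0 kE; have := max_star_count_upper n k0 kE.
rewrite /max_induced_density card_ord natrM.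
set M : R := (max_induced_count S3 n)%:R; set x : R := n%:R => up lo.
have -> : harmonic n = (x + 1)^-1 :> R by rewrite /harmonic /= -natr1.
(* From 4 on, [x * (x - 1) * (x - 2)] is positive and [h] is at most [1 / 5]; the constant 20 then
   absorbs the lower order terms. *)
have x4 : 4 <= x by rewrite (ler_nat R 4).
have k1 : k <= 1 / 6 by nra.
have binE : 'C(n, 3)%:R = x * (x - 1) * (x - 2) / 6 :> R.
  have : ('C(n, 3) * 3`!)%:R = (n ^_ 3)%:R :> R by rewrite bin_ffact.
  rewrite natrM (_ : 3`! = 6)%N // => e.
  apply: (canRL (mulfK _)); first by apply/negP => /eqP; lra.
  (* Exposing two successors makes the truncated predecessors in the falling factorial agree with
     real subtraction. *)
  rewrite e; case: n n4 @x {up lo x4 e M} => [|[|n]] // _ x.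
  by rewrite !ffactnS /= ffactn0 muln1 !natrM /x -!natr1; ring.
have q0 : 0 < x * (x - 1) * (x - 2) by rewrite !mulr_gt0 //; lra.
have x0 : 0 < x + 1 by lra.
rewrite binE invf_div.
have -> : M * (6 / (x * (x - 1) * (x - 2))) = 6 * M / (x * (x - 1) * (x - 2)).
  by rewrite mulrA (mulrC M).
rewrite ler_pdivlMr // ler_pdivrMr //.
have hE : (x + 1) * (x + 1)^-1 = 1 by rewrite divff //; apply/negP => /eqP; lra.
set h := (x + 1)^-1 in hE *.
have h0 : 0 < h by rewrite invr_gt0.
have h5 : h <= 1 / 5 by nra.
(* This turns the error [h * x ^+ 3] into a quadratic one, comparable with the lower order terms of
   the count. *)
have xh : x * h = 1 - h by lra.
apply/andP; split.
  have -> : (3 * k - 20 * h) * (x * (x - 1) * (x - 2)) =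
    3 * k * x ^+ 3 - x * (3 * k * (3 * x - 2) + 20 * ((x * h) * x - 3 * (x * h) + 2 * h)) by ring.
  rewrite xh.
  nra.
have -> : (3 * k + 20 * h) * (x * (x - 1) * (x - 2)) =
    3 * k * x ^+ 3 + x * (20 * ((x * h) * x - 3 * (x * h) + 2 * h) - 3 * k * (3 * x - 2)) by ring.
rewrite xh.
nra.
Qed.

Local Open Scope classical_set_scope.

Theorem theorem3p4 (R : realType) :
  max_induced_density R S3 n @[n --> \oo] --> (2 * Num.sqrt 3 - 3 : R).
Proof.
(* Writing [2 / sqrt 3] as [2 / 3 * s] makes [k] polynomial in [s], so its quadratic equation
   follows from [s ^+ 2 = 3]. *)
pose s : R := Num.sqrt 3; pose k := 2 / 3 * s - 1.
have s2 : s ^+ 2 = 3 by rewrite sqr_sqrtr //; lra.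
have s0 : 0 <= s by apply: sqrtr_ge0.
have k0 : 0 <= k by rewrite /k; nra.
have kE : 3 * k ^+ 2 + 6 * k = 1.
  have -> : 3 * k ^+ 2 + 6 * k = 4 / 3 * s ^+ 2 - 3 by rewrite /k; field.
  by rewrite s2; field.
have -> : 2 * Num.sqrt 3 - 3 = 3 * k by rewrite /k -/s; field.
have h0 : 20 * harmonic n @[n --> \oo] --> (0 : R).
  rewrite -[X in _ --> X](mulr0 20).
  by apply: cvgM; [exact: cvg_cst | exact: cvg_harmonic].
apply: (@squeeze_cvgr _ _ _ _ (fun n => 3 * k - 20 * harmonic n)
  (fun n => 3 * k + 20 * harmonic n)).
- by exists 4%N => // n /= n4; apply: max_induced_density_S3_close.
- by rewrite -[X in _ --> X]subr0; apply: cvgB => //; exact: cvg_cst.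
- by rewrite -[X in _ --> X]addr0; apply: cvgD => //; exact: cvg_cst.
Qed.
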